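(* Let $F$ be a Lozi-like map defined by a pair of synchronously hyperbolic $C^1$ diffeomorphisms $F_1,F_2$ and a divider $\Gamma$, with the attractor $\Lambda$. Let $\pi:\Sigma_\Lambda\to\Lambda$ be the map such that $\bar p$ is an itinerary of $\pi(\bar p)$ for every $\bar p\in\Sigma_\Lambda$. Then $\pi$ is continuous.
   Context: ''Smooth'' means of class $C^1$. A cone in $\mathbb{R}^2$ is a set $K=\{\mathbf{u}: |\mathbf{u}\cdot\mathbf{v}|\ge \ell\|\mathbf{u}\|\}$ given by a unit vector $\mathbf{v}$ and $\ell\in(0,1)$; its axis is $\{t\mathbf{v}:t\in\mathbb{R}\}$. Two cones are disjoint if they intersect only in $\mathbf{0}$. A pair of cones $K^u,K^s$ is universal if they are disjoint, the axis of $K^u$ is the $x$-axis and the axis of $K^s$ is the $y$-axis. A cone field on an open set $U\subseteq\mathbb{R}^2$ assigns to each $P\in U$ a cone $K_P$ whose axis $\mathbf{v}(P)$ and coefficient $\ell(P)$ vary continuously with $P$. A smooth curve with all tangent vectors in a cone with axis the $x$-axis (resp. $y$-axis) is a graph $y=f(x)$ (resp. $x=f(y)$); it is infinite in both directions if the domain of $f$ is $\mathbb{R}$. $C^1$ diffeomorphisms $F_1,F_2:\mathbb{R}^2\to\mathbb{R}^2$ are synchronously hyperbolic if they are either both orientation reversing or both orientation preserving, and there exist $\lambda>1$ (the stretching factor), a universal pair of cones $K^u,K^s$, and cone fields $(K^u_P)_{P\in\mathbb{R}^2}$, $(K^s_P)_{P\in\mathbb{R}^2}$ such that: (S1) for every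 $P\in\mathbb{R}^2$ and $i=1,2$: $K^u_P\subset K^u$, $K^s_P\subset K^s$, $(DF_i)_P(K^u_P)\subset K^u_{F_i(P)}$, and $(DF_i^{-1})_P(K^s_P)\subset K^s_{F_i^{-1}(P)}$; (S2) for every $P$ and $i=1,2$: $\|(DF_i)_P(\mathbf{u})\|\ge\lambda\|\mathbf{u}\|$ for $\mathbf{u}\in K^u_P$ and $\|(DF_i^{-1})_P(\mathbf{w})\|\ge\lambda\|\mathbf{w}\|$ for $\mathbf{w}\in K^s_P$; (S3) there is a smooth curve $\Gamma\subset\mathbb{R}^2$, infinite in both directions, such that for every $P\in\Gamma$ we have $F_1(P)=F_2(P)$, the vector tangent to $\Gamma$ at $P$ belongs to $K^s_P$, and the vector tangent to $F_i(\Gamma)$ at $F_i(P)$ belongs to $K^u_{F_i(P)}$. $\Gamma$ is called the divider; it divides the plane into the left half-plane and the right half-plane, and $F_1(\Gamma)=F_2(\Gamma)$ divides the plane into the upper half-plane and the lower half-plane (each half-plane is taken with its boundary curve). Without loss of generality $F_1$ and $F_2$ map the left half-plane onto the lower one and the right half-plane onto the upper one; this is a standing convention. A trapping region for a map is a nonempty set that is mapped with its closure into its interior. Given synchronously hyperbolic $F_1,F_2$ with divider $\Gamma$, let $F(P)=F_1(P)$ for $P$ in the left half-plane and $F(P)=F_2(P)$ for $P$ in the right half-plane. $F$ (a homeomorphism of $\mathbb{R}^2$) is called Lozi-like if (L1) $-1<\det DF_i(P)<0$ for every $P\in\mathbb{R}^2$ and $i=1,2$; and (L2) there exists a trapping region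 $\Delta$ for $F$ which is homeomorphic to an open disk and whose closure is homeomorphic to a closed disk. ''With the attractor $\Lambda$'' means that $\Lambda=\bigcap_{n=0}^\infty F^n(\Delta)$ and $F|_\Lambda$ is topologically transitive. Coding: to a point $P\in\Lambda$ one assigns a bi-infinite sequence $\bar p=(p_n)_{n\in\mathbb{Z}}$ of signs $+$ and $-$ such that $p_n=-$ if $F^n(P)$ is in the left half-plane and $p_n=+$ if $F^n(P)$ is in the right half-plane; when $F^n(P)\in\Gamma$ both choices are allowed, so a point may have more than one such sequence. Any such sequence is called an itinerary of $P$. A bi-infinite sequence is admissible if it is an itinerary of some point of $\Lambda$; $\Sigma_\Lambda$ is the set of all admissible sequences, with the usual product topology (as a subspace of $\{+,-\}^{\mathbb{Z}}$). For every $\bar p\in\Sigma_\Lambda$ there is exactly one point of $\Lambda$ with itinerary $\bar p$, so $\pi$ is well defined. *)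

(* Defs.v *)
From HB Require Import structures.
From mathcomp Require Import all_boot all_order all_algebra.
From mathcomp Require Import all_classical all_reals all_analysis.
Import Order.TTheory GRing.Theory Num.Theory.
Import numFieldNormedType.Exports.

Set Implicit Arguments.
Unset Strict Implicit.
Unset Printing Implicit Defensive.

Local Open Scope classical_set_scope.
Local Open Scope ring_scope.

Section plane.
Context {R : realType}.
Local Notation plane := 'rV[R]_2.

Definition xcoord (P : plane) : R := P 0 0.
Definition ycoord (P : plane) : R := P 0 1.
Definition mkpoint (x y : R) : plane := \row_j (if j == 0 then x else y).

Definition dot (u v : plane) : R := \sum_j u 0 j * v 0 j.
(* The library norm on ['rV[R]_2] is the sup norm, so the Euclidean norm is
   defined here; both induce the same topology. *)
Definition enorm (u : plane) : R := Num.sqrt (dot u u).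

Definition C1_map (F : plane -> plane) : Prop :=
  (forall P, differentiable F P) /\ continuous (fun P => 'J F P).

(* The inverse, when [F] is bijective. *)
Definition inv_map (F : plane -> plane) (Q : plane) : plane :=
  get [set P | F P = Q].

Definition C1_diffeo (F : plane -> plane) : Prop :=
  [/\ bijective F, C1_map F & C1_map (inv_map F)].

(* [Negz k] stands for the integer [- k.+1]. *)
Definition iterz (F : plane -> plane) (n : int) : plane -> plane :=
  match n with
  | Posz k => iter k F
  | Negz k => iter k.+1 (inv_map F)
  end.

Definition orientation_preserving (F : plane -> plane) : Prop :=
  forall P, 0 < \det ('J F P).
Definition orientation_reversing (F : plane -> plane) : Prop :=
  forall P, \det ('J F P) < 0.

Definition cone (v : plane) (l : R) : set plane :=
  [set u | l * enorm u <= `|dot u v|].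

Definition universal_pair (Ku Ks : set plane) : Prop :=
  exists lu ls : R,
    [/\ 0 < lu < 1, 0 < ls < 1,
        Ku = cone (mkpoint 1 0) lu, Ks = cone (mkpoint 0 1) ls
      & Ku `&` Ks = [set 0]].

(* The axis is a line, that is, a unit vector up to sign.  As the plane is
   simply connected, the axis of a cone field on the plane varies continuously
   iff the unit vector can be chosen continuously. *)
Definition cone_field (K : plane -> set plane) : Prop :=
  exists (v : plane -> plane) (l : plane -> R),
    [/\ continuous v, continuous l,
        forall P, enorm (v P) = 1,
        forall P, 0 < l P < 1
      & forall P, K P = cone (v P) (l P)].

(* A smooth curve with all tangent vectors in a cone around the y-axis is a
   graph x = g(y); it is infinite in both directions when [g] is defined on
   the whole line. *)
Definition infinite_vertical_curve (G : set plane) : Prop :=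
  exists g : R -> R,
    [/\ forall y, derivable g y 1,
        continuous (derive1 g)
      & G = [set P | xcoord P = g (ycoord P)]].

Definition tangent_vector (A : set plane) (P v : plane) : Prop :=
  exists c : R -> plane,
    [/\ c 0 = P, \forall t \near (0 : R), A (c t)
      & is_derive (0 : R) (1 : R) c v].

(* Closed half-planes bounded by a graph x = g(y) (left and right), resp. by a
   graph y = h(x) (lower and upper). *)
Definition left_half (G : set plane) : set plane :=
  [set P | exists Q, [/\ G Q, ycoord Q = ycoord P & xcoord P <= xcoord Q]].
Definition right_half (G : set plane) : set plane :=
  [set P | exists Q, [/\ G Q, ycoord Q = ycoord P & xcoord Q <= xcoord P]].
Definition lower_half (G : set plane) : set plane :=
  [set P | exists Q, [/\ G Q, xcoord Q = xcoord P & ycoord P <= ycoord Q]].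
Definition upper_half (G : set plane) : set plane :=
  [set P | exists Q, [/\ G Q, xcoord Q = xcoord P & ycoord Q <= ycoord P]].

Definition cones_invariant (F : plane -> plane) (Ku Ks : set plane)
    (KuP KsP : plane -> set plane) : Prop :=
  forall P,
    [/\ KuP P `<=` Ku, KsP P `<=` Ks,
        'd F P @` KuP P `<=` KuP (F P)
      & 'd (inv_map F) P @` KsP P `<=` KsP (inv_map F P)].

Definition cones_stretched (F : plane -> plane) (lambda : R)
    (KuP KsP : plane -> set plane) : Prop :=
  forall P,
    (forall u, KuP P u -> lambda * enorm u <= enorm ('d F P u)) /\
    (forall w, KsP P w -> lambda * enorm w <= enorm ('d (inv_map F) P w)).

Definition divider (F1 F2 : plane -> plane) (KuP KsP : plane -> set plane)
    (Gamma : set plane) : Prop :=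
  infinite_vertical_curve Gamma /\
  forall P, Gamma P ->
    [/\ F1 P = F2 P,
        forall v, tangent_vector Gamma P v -> KsP P v,
        forall v, tangent_vector (F1 @` Gamma) (F1 P) v -> KuP (F1 P) v
      & forall v, tangent_vector (F2 @` Gamma) (F2 P) v -> KuP (F2 P) v].

Definition synchronously_hyperbolic (F1 F2 : plane -> plane)
    (Gamma : set plane) : Prop :=
  [/\ C1_diffeo F1, C1_diffeo F2,
      (orientation_reversing F1 /\ orientation_reversing F2) \/
      (orientation_preserving F1 /\ orientation_preserving F2)
    & exists (lambda : R) (Ku Ks : set plane) (KuP KsP : plane -> set plane),
        [/\ 1 < lambda, universal_pair Ku Ks, cone_field KuP & cone_field KsP] /\
        [/\ cones_invariant F1 Ku Ks KuP KsP, cones_invariant F2 Ku Ks KuP KsP,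
            cones_stretched F1 lambda KuP KsP, cones_stretched F2 lambda KuP KsP
          & divider F1 F2 KuP KsP Gamma]].

(* The normalization made without loss of generality for every pair of
   synchronously hyperbolic maps. *)
Definition left_to_lower (F : plane -> plane) (Gamma : set plane) : Prop :=
  F @` left_half Gamma = lower_half (F @` Gamma) /\
  F @` right_half Gamma = upper_half (F @` Gamma).

(* The two branches agree on [Gamma], the common part of the half-planes. *)
Definition lozi_map (F1 F2 : plane -> plane) (Gamma : set plane)
    (P : plane) : plane :=
  if `[< left_half Gamma P >] then F1 P else F2 P.

Definition trapping_region (F : plane -> plane) (D : set plane) : Prop :=
  D !=set0 /\ F @` closure D `<=` interior D.

Definition homeomorphic (A B : set plane) : Prop :=
  exists f g : plane -> plane,
    [/\ {within A, continuous f}, {within B, continuous g},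
        f @` A `<=` B, g @` B `<=` A
      & (forall P, A P -> g (f P) = P) /\ (forall Q, B Q -> f (g Q) = Q)].

Definition trapping_disk (F : plane -> plane) (D : set plane) : Prop :=
  [/\ trapping_region F D,
      homeomorphic D [set P | enorm P < 1]
    & homeomorphic (closure D) [set P | enorm P <= 1]].

Definition lozi_like (F1 F2 : plane -> plane) (Gamma : set plane) : Prop :=
  [/\ synchronously_hyperbolic F1 F2 Gamma,
      left_to_lower F1 Gamma, left_to_lower F2 Gamma,
      forall P, (-1 < \det ('J F1 P) < 0) /\ (-1 < \det ('J F2 P) < 0)
    & exists D, trapping_disk (lozi_map F1 F2 Gamma) D].

Definition topologically_transitive (F : plane -> plane) (L : set plane) :
    Prop :=
  forall U V : set plane, open U -> open V ->
    (L `&` U) !=set0 -> (L `&` V) !=set0 ->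
    exists n : nat, (iter n F @` (L `&` U) `&` (L `&` V)) !=set0.

Definition attractor (F : plane -> plane) (L : set plane) : Prop :=
  exists D, [/\ trapping_disk F D,
    L = \bigcap_(n in [set: nat]) (iter n F @` D)
  & topologically_transitive F L].

(* [false] is the sign -, [true] is the sign +. *)

Definition itinerary (F : plane -> plane) (Gamma : set plane) (P : plane)
    (p : {ptws int -> bool}) : Prop :=
  forall n : int,
    if p n then right_half Gamma (iterz F n P)
    else left_half Gamma (iterz F n P).

Definition admissible (F : plane -> plane) (Gamma L : set plane) :
    set {ptws int -> bool} :=
  [set p | exists2 P, L P & itinerary F Gamma P p].

End plane.

(* Main.v *)
Require Import Defs.
From HB Require Import structures.
From mathcomp Require Import all_boot all_order all_algebra.
From mathcomp Require Import all_classical all_reals all_analysis.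
From mathcomp Require Import ring lra.
Import Order.TTheory GRing.Theory Num.Theory.
Import numFieldNormedType.Exports.
Set Implicit Arguments.
Unset Strict Implicit.
Unset Printing Implicit Defensive.

Local Open Scope classical_set_scope.
Local Open Scope ring_scope.

(** Two points of the attractor whose itineraries agree at the times
    - N, ..., N - 1 are at distance O(lambda ^ (- N)), see [same_window_close].
    The sequences that agree with a given one on that window form a
    neighbourhood of it, so this estimate is the continuity of [pi]; it also
    contains the fact that a point is determined by its itinerary.

    Let P and Q be two such points.  During the window their orbits are moved
    by the same branches: a composition h of N forward branches sends P, Q to
    F^N P, F^N Q, and a composition e of N inverse branches sends them to
    F^(-N) P, F^(-N) Q.  These four points lie in the bounded trapping region.
    Both h and e are diffeomorphisms of the whole plane, and the cone conditions
    hold on the whole plane, whatever the half-planes; hence h expands the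
    unstable cones and e the stable cones, by lambda ^ N at least
    ([hyperbolic_orbit]).

    Put Phi z = (x (h z), y (e z)).  Each vector at z is u + s, where u is
    pulled back by e from the unstable cone at e z, and s is pulled back by h
    from the stable cone at h z.  The derivative of h stretches u by
    lambda ^ N, keeps it within the unstable cone, and shrinks s by
    lambda ^ N; for e the roles are exchanged.  So the derivative of Phi
    stretches every vector by a constant times lambda ^ N
    ([hyperbolic_cross]).  As Phi P - Phi Q is bounded independently of N, it
    remains to pass from vectors to distances ([hyperbolic_expansive]).

    This passage is [expanding_distances], a quantitative form of Hadamard's
    global inverse function theorem: a C1 map f from R^n to R^n whose
    derivative stretches all vectors by a expands all distances by any b < a.
    The segment from f P to f Q has to be lifted to a path from P to Q, and the
    lift is found as a discrete geodesic.  Among the chains P = z_0, ...,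
    z_m = Q with short steps in a fixed ball, take one that minimises
    the sum of the squared Euclidean norms of f z_(k+1) - f z_k.  For m large
    the bounds on the steps and on the ball are strict for the minimiser, so
    that each inner z_k can be moved freely; as the derivative of f is onto,
    f z_k is then the midpoint of its two neighbours.  Hence the f z_k cut
    the segment from f P to f Q into m equal parts, and adding up the local
    expansion along the m short steps gives the claim.

    Backward orbits are taken with the inverse of F, so F has to be injective
    ([lozi_injective]).  The images of the left and of the right half-plane can
    overlap only along F1(Gamma), provided that each vertical line meets this
    curve at most once; this holds because its tangent vectors are in the
    unstable cones ([image_graph_single_valued]). *)

(** * Row vectors and continuously differentiable maps *)

Section c1_maps.
Context {R : realType}.

Lemma entry_le_norm m n (M : 'M[R]_(m, n)) i j : `|M i j| <= `|M|.
Proof.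
rewrite [leRHS]/Num.norm /= mx_normrE.
by apply/bigmax_geP; right => /=; exists (i, j).
Qed.

Lemma row_norm_le n (v : 'rV[R]_n) c :
  0 <= c -> (forall j, `|v 0 j| <= c) -> `|v| <= c.
Proof.
move=> c0 h; rewrite [leLHS]/Num.norm /= mx_normrE.
by apply/bigmax_leP; split => //= -[i j] _ /=; rewrite ord1.
Qed.

Lemma norm_mulmx_le m n (v : 'rV[R]_m) (M : 'M[R]_(m, n)) :
  `|v *m M| <= m%:R * `|M| * `|v|.
Proof.
apply: row_norm_le => [|j]; first by rewrite !mulr_ge0.
rewrite mxE (le_trans (ler_norm_sum _ _ _))//.
have -> : m%:R * `|M| * `|v| = \sum_(i < m) (`|v| * `|M|).
  by rewrite sumr_const card_ord -mulrA mulr_natl [`|M| * _]mulrC.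
by apply: ler_sum => i _; rewrite normrM ler_pM ?entry_le_norm.
Qed.

Definition C1 m n (f : 'rV[R]_m -> 'rV[R]_n) : Prop :=
  (forall z, differentiable f z) /\ continuous (fun z => 'J f z).

Lemma diff_jacobian m n (f : 'rV[R]_m -> 'rV[R]_n) z w : 'd f z w = w *m 'J f z.
Proof. by rewrite /jacobian mul_rV_lin1. Qed.

(** The point x ranges over the compact set but y does not: the ball around x
    of radius d may leave K. *)
Lemma compact_unif_continuous m (V : normedModType R)
    (f : 'rV[R]_m -> V) (K : set 'rV[R]_m) (e : R) :
  continuous f -> compact K -> 0 < e ->
  exists2 d, 0 < d & forall x, K x -> forall y, `|y - x| <= d ->
    `|f y - f x| <= e.
Proof.
move=> cf /compact_near_coveringP cK e0.
have := cK R (0^'+) (fun d x => forall y, `|y - x| <= d -> `|f y - f x| <= e) _.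
case.
  move=> x Kx.
  have /cvgrPdist_le/(_ (e / 2)) := cf x; rewrite divr_gt0// => /(_ isT).
  move=> /nbhs_ballP[r r0 hr]; rewrite /= in r0.
  have r20 : 0 < r / 2 by rewrite divr_gt0.
  exists (ball x (r / 2), [set d | d < r / 2]); first split => /=.
  - exact: nbhsx_ballx.
  - exact: nbhs_right_lt.
  - move=> [y d] /= []; rewrite -ball_normE /= => xy dr z zy.
    have hy : `|f x - f y| <= e / 2.
      by apply: hr; rewrite -ball_normE /=; lra.
    have hz : `|f x - f z| <= e / 2.
      apply: hr; rewrite -ball_normE /=.
      have -> : x - z = (x - y) - (z - y) by rewrite opprB addrA subrK.
      by apply: le_lt_trans (ler_normB _ _) _; lra.
    have -> : f z - f y = (f x - f y) - (f x - f z).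
      by rewrite opprB [RHS]addrC subrKA.
    by apply: le_trans (ler_normB _ _) _; lra.
move=> d /= d0 hd.
have := hd (d / 2); rewrite /ball_ /= sub0r normrN => h.
exists (d / 2); first by rewrite divr_gt0.
move=> x Kx; apply: h => //.
  by rewrite gtr0_norm ?divr_gt0// ltr_pdivrMr// ltr_pMr// ltr1n.
by rewrite divr_gt0.
Qed.

Lemma is_derive_coord n (c : R -> 'rV[R]_n) (t : R) j :
  differentiable c t -> is_derive t 1 (fun s => c s 0 j) ('d c t 1 0 j).
Proof.
move=> dc.
have dj := differentiable_coord (c t) 0 j.
have dt : differentiable (fun s : R => c s 0 j : R) t.
  exact: (@differentiable_comp _ _ _ _ c (fun N : 'rV[R]_n => N 0 j)).
apply: DeriveDef; first exact/derivable1_diffP.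
rewrite deriveE// (@diff_comp _ _ _ _ c (fun N : 'rV[R]_n => N 0 j))//=.
have @g : {linear 'rV[R]_n -> R}.
  by exists (fun N : 'rV[R]_n => N 0 j); do 2![eexists]; do ?[constructor];
     rewrite ?mxE// => ? *; rewrite ?mxE//; move=> ?; rewrite !mxE.
by rewrite (@diff_lin _ _ _ g)//; exact: coord_continuous.
Qed.

Lemma is_derive_line m n (f : 'rV[R]_m -> 'rV[R]_n) z w j (t : R) :
  (forall x, differentiable f x) ->
  is_derive t 1 (fun t => f (z + t *: w) 0 j) ((w *m 'J f (z + t *: w)) 0 j).
Proof.
move=> df.
have dl (s : R) : is_diff s (fun s : R => z + s *: w) (fun s => s *: w).
  have h1 : is_diff s (fun s : R => s *: w) (fun s => s *: w).
    exact: is_diff_scalel.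
  have h2 : is_diff s (cst z : R -> 'rV[R]_m) 0 by exact: is_diff_cst.
  have h : is_diff s (cst z + (fun s : R => s *: w)) (0 + (fun s : R => s *: w)).
    exact: is_diffD.
  by rewrite add0r in h.
have dc : differentiable (fun t : R => f (z + t *: w)) t.
  by apply: differentiable_comp.
apply: is_derive_eq; first exact: is_derive_coord dc.
by rewrite diff_comp//= diff_val scale1r diff_jacobian.
Qed.

(** The mean value theorem is applied to each coordinate along the segment from
    z to z + w, where the Jacobian is uniformly close to its value at z. *)
Lemma C1_uniformly_differentiable m n (f : 'rV[R]_m -> 'rV[R]_n)
    (K : set 'rV[R]_m) (e : R) :
  C1 f -> compact K -> 0 < e ->
  exists2 d, 0 < d & forall z, K z -> forall w, `|w| <= d ->
    `|f (z + w) - f z - w *m 'J f z| <= e * `|w|.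
Proof.
move=> [df cJ] cK e0.
have e'0 : 0 < e / m.+1%:R by rewrite divr_gt0.
have [d d0 hd] := compact_unif_continuous cJ cK e'0.
exists d => // z Kz w wd.
apply: row_norm_le => [|j]; first by rewrite mulr_ge0// ltW.
have hder (t : R) := @is_derive_line _ _ f z w j t df.
have hcont : {within `[0, 1], continuous (fun t => f (z + t *: w) 0 j)}.
  apply: continuous_subspaceT => x.
  by apply: differentiable_continuous; apply/derivable1_diffP.
have [c] := MVT ltr01 (fun x _ => hder x) hcont.
rewrite in_itv /= => /andP[c0 c1]; rewrite subr0 mulr1 scale1r scale0r addr0 => E.
have subE (A B : 'rV[R]_n) : (A - B) 0 j = A 0 j - B 0 j by rewrite !mxE.
have -> : (f (z + w) - f z - w *m 'J f z) 0 j =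
   (w *m ('J f (z + c *: w) - 'J f z)) 0 j.
  by rewrite mulmxBr 3!subE E.
apply: le_trans (entry_le_norm _ _ _) _.
apply: le_trans (norm_mulmx_le _ _) _.
apply: ler_wpM2r => //.
have : `|'J f (z + c *: w) - 'J f z| <= e / m.+1%:R.
  apply: hd => //; have -> : z + c *: w - z = c *: w by rewrite addrC addKr.
  rewrite normrZ gtr0_norm//.
  by apply: le_trans wd; rewrite ler_piMl// ltW.
rewrite ler_pdivlMr// => h; apply: le_trans h; rewrite mulrC ler_wpM2l//.
by rewrite ler_nat.
Qed.

Lemma continuous_mx (T : topologicalType) m n (A : T -> 'M[R]_(m, n)) :
  (forall i j, continuous (fun t => A t i j)) -> continuous A.
Proof.
move=> h t P [Q nQ QP].
suff : \forall s \near t, forall i j, Q i j (A s i j).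
  by apply: filterS => s hs; exact: QP.
apply: filter_forall => i; apply: filter_forall => j.
exact: (h i j t _ (nQ i j)).
Qed.

Lemma continuous_mulmx (T : topologicalType) m n p
    (A : T -> 'M[R]_(m, n)) (B : T -> 'M[R]_(n, p)) :
  continuous A -> continuous B -> continuous (fun t => A t *m B t).
Proof.
move=> cA cB; apply: continuous_mx => i j.
under eq_fun do rewrite mxE.
apply: continuous_big => [|k _ t]; first exact: add_continuous.
by apply: cvgM; apply: (continuous_comp _ (@coord_continuous _ _ _ _ _ _));
  [exact: cA|exact: cB].
Qed.

Lemma diff_compE m n p (f : 'rV[R]_m -> 'rV[R]_n) (g : 'rV[R]_n -> 'rV[R]_p) z w :
  differentiable f z -> differentiable g (f z) ->
  'd (g \o f) z w = 'd g (f z) ('d f z w).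
Proof. by move=> df dg; rewrite diff_comp. Qed.

Lemma jacobian_comp m n p (f : 'rV[R]_m -> 'rV[R]_n) (g : 'rV[R]_n -> 'rV[R]_p) z :
  differentiable f z -> differentiable g (f z) ->
  'J (g \o f) z = 'J f z *m 'J g (f z).
Proof.
move=> df dg; apply/row_matrixP => i.
by rewrite !rowE -!diff_jacobian diff_compE// !diff_jacobian mulmxA.
Qed.

Lemma C1_comp m n p (f : 'rV[R]_m -> 'rV[R]_n) (g : 'rV[R]_n -> 'rV[R]_p) :
  C1 f -> C1 g -> C1 (g \o f).
Proof.
move=> [df cf] [dg cg]; split => [z|]; first exact: differentiable_comp.
have -> : (fun z => 'J (g \o f) z) = (fun z => 'J f z *m 'J g (f z)).
  by apply/funext => z; exact: jacobian_comp.
apply: continuous_mulmx => // z.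
apply: (@continuous_comp _ _ _ f (fun z => 'J g z)).
  exact: differentiable_continuous.
exact: cg.
Qed.

Lemma is_diff_mulmxr m n (A : 'M[R]_(m, n)) z :
  is_diff z (fun x : 'rV[R]_m => x *m A) (fun x => x *m A).
Proof.
have c : continuous (fun x : 'rV[R]_m => x *m A).
  apply: continuous_mulmx; first by move=> x; exact: cvg_id.
  exact: cst_continuous.
apply: DiffDef; first exact: (@linear_differentiable _ _ _ (mulmxr A)).
exact: (@diff_lin _ _ _ (mulmxr A)).
Qed.

Lemma C1_mulmxr m n (A : 'M[R]_(m, n)) : C1 (fun x : 'rV[R]_m => x *m A).
Proof.
split => [z|]; first by have [] := is_diff_mulmxr A z.
have -> : (fun z => 'J (fun x : 'rV[R]_m => x *m A) z) = cst A.
  apply/funext => z; apply/row_matrixP => i.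
  have h := is_diff_mulmxr A z.
  by rewrite !rowE -diff_jacobian diff_val.
exact: cst_continuous.
Qed.

Lemma jacobianD m n (f g : 'rV[R]_m -> 'rV[R]_n) z :
  differentiable f z -> differentiable g z -> 'J (f + g) z = 'J f z + 'J g z.
Proof.
move=> df dg; apply/matrixP => i j.
have JE (h : 'rV[R]_m -> 'rV[R]_n) : 'J h z i j = 'd h z (delta_mx 0 i) 0 j.
  by rewrite /jacobian mxE.
have E := congr1 (fun h : 'rV[R]_m -> 'rV[R]_n => h (delta_mx 0 i)) (diffD df dg).
transitivity (('d f z (delta_mx 0 i) + 'd g z (delta_mx 0 i)) 0 j).
  apply: etrans (JE (f + g)) _.
  exact: (congr1 (fun v : 'rV[R]_n => v 0 j) E).
rewrite [LHS]mxE [RHS]mxE.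
by congr (_ + _); apply: esym; exact: JE.
Qed.

Lemma C1_add m n (f g : 'rV[R]_m -> 'rV[R]_n) : C1 f -> C1 g -> C1 (f + g).
Proof.
move=> [df cf] [dg cg]; split => [z|]; first exact: differentiableD.
have -> : (fun z => 'J (f + g) z) = (fun z => 'J f z + 'J g z).
  by apply/funext => z; exact: jacobianD.
by move=> z; exact: (cvgD (cf z) (cg z)).
Qed.

Lemma C1_id n : C1 (@id 'rV[R]_n).
Proof.
have := @C1_mulmxr n n 1%:M; congr C1; apply/funext => x; exact: mulmx1.
Qed.

End c1_maps.

(** * Globally expanding maps *)

Section discrete_geodesics.
Context {R : realType}.

(** The Euclidean square is smooth, unlike the sup norm of row vectors, so a
    minimiser of sums of such squares is a critical point. *)
Definition sqn n (w : 'rV[R]_n) : R := \sum_j (w 0 j) ^+ 2.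

Lemma sqn_ge0 n (w : 'rV[R]_n) : 0 <= sqn w.
Proof. by apply: sumr_ge0 => j _; exact: sqr_ge0. Qed.

Lemma sqn_eq0 n (w : 'rV[R]_n) : sqn w = 0 -> w = 0.
Proof.
move=> /eqP; rewrite psumr_eq0; last by move=> j _; exact: sqr_ge0.
move=> /allP h; apply/rowP => j; rewrite mxE.
by have := h j; rewrite mem_index_enum sqrf_eq0 => /(_ isT)/eqP.
Qed.

Lemma norm2_le_sqn n (w : 'rV[R]_n) : `|w| ^+ 2 <= sqn w.
Proof.
rewrite -[leRHS]sqr_sqrtr ?sqn_ge0// ler_sqr ?nnegrE ?sqrtr_ge0//.
apply: row_norm_le => [|j]; first exact: sqrtr_ge0.
rewrite -sqrtr_sqr ler_wsqrtr// /sqn (bigD1 j)//= lerDl.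
by apply: sumr_ge0 => i _; exact: sqr_ge0.
Qed.

Lemma sqn_le_norm2 n (w : 'rV[R]_n) : sqn w <= n%:R * `|w| ^+ 2.
Proof.
have -> : n%:R * `|w| ^+ 2 = \sum_(i < n) `|w| ^+ 2.
  by rewrite sumr_const card_ord mulr_natl.
apply: ler_sum => j _; rewrite -real_normK ?num_real// ler_sqr ?nnegrE//.
exact: entry_le_norm.
Qed.

Lemma sqn_continuous n : continuous (@sqn n).
Proof.
apply: continuous_big => [|j _ w]; first exact: add_continuous.
apply: (@continuous_comp _ _ _ (fun w : 'rV[R]_n => w 0 j) (fun x => x ^+ 2)).
  exact: coord_continuous.
exact: exprn_continuous.
Qed.

(** Fermat's rule in the direction w for which the derivative of f is
    (f z - a) - (b - f z): the derivative of the minimised quantity in that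
    direction is twice the square of this vector. *)
Lemma critical_midpoint n (f : 'rV[R]_n -> 'rV[R]_n) (a b z : 'rV[R]_n) :
  (forall x, differentiable f x) -> 'J f z \in unitmx ->
  (forall w, \forall t \near (0 : R),
     sqn (f z - a) + sqn (b - f z) <=
     sqn (f (z + t *: w) - a) + sqn (b - f (z + t *: w))) ->
  f z - a = b - f z.
Proof.
move=> df Ju hmin.
pose u := (f z - a) - (b - f z).
pose w := u *m invmx ('J f z).
have wu : w *m 'J f z = u by rewrite /w mulmxKV.
pose phi (j : 'I_n) (t : R) : R := f (z + t *: w) 0 j.
pose g (j : 'I_n) : R -> R :=
  (phi j - cst (a 0 j)) ^+ 2 + (cst (b 0 j) - phi j) ^+ 2.
pose h : R -> R := \sum_j g j.
have hE t : h t = sqn (f (z + t *: w) - a) + sqn (b - f (z + t *: w)).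
  rewrite /h fct_sumE /sqn -big_split/=; apply: eq_bigr => j _.
  by rewrite !mxE.
pose dphi (j : 'I_n) (t : R) : R := (w *m 'J f (z + t *: w)) 0 j.
pose dg t (j : 'I_n) : R :=
  (2%:R * (phi j - cst (a 0 j)) t ^+ 1) *: (dphi j t - 0) +
  (2%:R * (cst (b 0 j) - phi j) t ^+ 1) *: (0 - dphi j t).
have dgj (t : R) j : is_derive t 1 (g j) (dg t j).
  have dp : is_derive t 1 (phi j) (dphi j t) by exact: is_derive_line.
  by apply: is_deriveD; apply: is_deriveX; apply: is_deriveB.
have dh (t : R) : is_derive t 1 h (\sum_j dg t j).
  exact: (is_derive_sum (dgj t)).
have /nbhs_ballP[r r0 hr] := hmin w.
have dh0 : is_derive (0 : R) 1 h 0.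
  apply: (@derive1_at_min _ h (- r) r 0).
  - by rewrite ge0_cp// ltW.
  - by move=> t _; apply: ex_derive; exact: dh.
  - by rewrite in_itv /= oppr_lt0 r0.
  - move=> t; rewrite in_itv /= => tr; rewrite !hE scale0r addr0.
    by apply: hr; rewrite -ball_normE /= sub0r normrN ltr_norml.
have : sqn u = 0.
  have := @derive_val _ _ _ _ _ _ _ (dh 0); rewrite (@derive_val _ _ _ _ _ _ _ dh0).
  move=> /esym E.
  apply: (mulfI (_ : 2%:R != 0)); first by rewrite pnatr_eq0.
  rewrite mulr0 -E mulr_sumr; apply: eq_bigr => j _.
  rewrite /dg /dphi scale0r addr0 wu sub0r subr0 !fctE /phi scale0r addr0.
  by rewrite !expr1 /u !mxE /GRing.scale /=; ring.
by move=> /sqn_eq0/eqP; rewrite /u subr_eq0 => /eqP.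
Qed.

Lemma closed_ball_compact n (P : 'rV[R]_n) r :
  compact [set z : 'rV[R]_n | `|z - P| <= r].
Proof.
apply: bounded_closed_compact.
  exists (`|P| + r); split; first exact: num_real.
  move=> x hx z /= zr; apply: le_trans (ltW hx).
  by rewrite -[z](subrK P) addrC (le_trans (ler_normD _ _))// lerD2l.
have c : continuous (fun z : 'rV[R]_n => `|z - P|).
  move=> z; apply: (@continuous_comp _ _ _ (fun z : 'rV[R]_n => z - P) Num.norm).
    apply: (@continuousB _ _ _ id (cst P) z); first exact: cvg_id.
    exact: cst_continuous.
  exact: norm_continuous.
by apply: (preimage_closed (f := fun z : 'rV[R]_n => `|z - P|) (D := [set x | x <= r]));
  [move=> x _; exact: c|exact: closed_le].
Qed.

Definition energy n (f : 'rV[R]_n -> 'rV[R]_n) m (z : nat -> 'rV[R]_n) : R :=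
  \sum_(k < m) sqn (f (z k.+1) - f (z k)).

(** Infinite sequences that stay at Q from index m on: compactness then comes
    from Tychonoff's theorem on functions from nat. *)
Definition chain n (P Q : 'rV[R]_n) r d m : set (nat -> 'rV[R]_n) :=
  [set z | [/\ z 0%N = P, forall k, (m <= k)%N -> z k = Q,
    forall k, `|z k - P| <= r & forall k, `|z k.+1 - z k| <= d]].

Definition update n (z : nat -> 'rV[R]_n) k y : nat -> 'rV[R]_n :=
  fun j => if j == k then y else z j.

Lemma update_id n (z : nat -> 'rV[R]_n) k : update z k (z k) = z.
Proof. by apply/funext => j; rewrite /update; case: eqP => // ->. Qed.

Lemma energy_update n (f : 'rV[R]_n -> 'rV[R]_n) m (z : nat -> 'rV[R]_n) k :
  (k.+1 < m)%N -> exists c, forall y,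
    energy f m (update z k.+1 y) =
    c + (sqn (f y - f (z k)) + sqn (f (z k.+2) - f y)).
Proof.
move=> km.
pose k0 := Ordinal (ltnW km); pose k1 := Ordinal km.
exists (\sum_(i < m | (i != k0) && (i != k1)) sqn (f (z i.+1) - f (z i))) => y.
rewrite /energy (bigD1 k0)//= (bigD1 k1)/=; last first.
  by apply/eqP => /(congr1 val)/= /eqP; rewrite gtn_eqF.
rewrite addrA addrC; congr (_ + _).
  apply: eq_bigr => i /andP[ik0 ik1]; rewrite /update.
  have /negPf -> : (i.+1 != k.+1)%N by rewrite eqSS; exact: ik0.
  by have /negPf -> : (i != k.+1 :> nat)%N by exact: ik1.
by rewrite /update !eqxx ltn_eqF// gtn_eqF.
Qed.

(** Chains form a closed subset of a product of compact sets, and the energy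
    depends on finitely many coordinates. *)
Lemma energy_minimizer n (f : 'rV[R]_n -> 'rV[R]_n) (P Q : 'rV[R]_n) r d m :
  continuous f -> chain P Q r d m !=set0 ->
  exists2 z, chain P Q r d m z &
    forall y, chain P Q r d m y -> energy f m z <= energy f m y.
Proof.
move=> cf A0.
pose T := {ptws nat -> 'rV[R]_n}.
have pc (k : nat) : continuous (fun z : T => z k).
  exact: (@proj_continuous nat (fun=> 'rV[R]_n) k).
have cA : compact (chain P Q r d m : set T).
  pose B (k : nat) : set 'rV[R]_n := [set x | [/\ k = 0%N -> x = P,
     (m <= k)%N -> x = Q & `|x - P| <= r]].
  have cB k : compact (B k).
    have -> : B k = [set x | `|x - P| <= r] `&`
        ([set x | k = 0%N -> x = P] `&` [set x | (m <= k)%N -> x = Q]).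
      by apply/seteqP; split => [x [? ? ?]|x [? [? ?]]]; split.
    have cl (b : Prop) (c : 'rV[R]_n) : closed [set x | b -> x = c].
      have [hb|hb] := pselect b.
        have -> : [set x | b -> x = c] = [set c].
          by apply/seteqP; split => [x /(_ hb)|x ->].
        apply: compact_closed; first exact: (@norm_hausdorff R 'rV[R]_n).
        exact: (@compact_set1 _ c).
      have -> : [set x | b -> x = c] = setT.
        by apply/seteqP; split => // x _ /hb.
      exact: closedT.
    by apply: compact_closedI; [exact: closed_ball_compact|exact: closedI].
  have -> : (chain P Q r d m : set T) =
      [set z : T | forall k, B k (z k)] `&`
      \bigcap_(k in [set: nat]) [set z : T | `|z k.+1 - z k| <= d].
    apply/seteqP; split => [z [z0 zm zr zd]|z [zB zd]]; split => //=.
    - by move=> k; split => [-> //||]; [exact: zm|exact: zr].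
    - by move=> k _; exact: zd.
    - by have [h _ _] := zB 0%N; exact: h.
    - by move=> k km; have [_ h _] := zB k; exact: h.
    - by move=> k; have [] := zB k.
    - by move=> k; exact: (zd k I).
  apply: compact_closedI; first exact: tychonoff.
  apply: closed_bigI => k _.
  have c : continuous (fun z : T => `|z k.+1 - z k|).
    move=> z; apply: (@continuous_comp _ _ _ (fun z : T => z k.+1 - z k) Num.norm).
      by apply: continuousB; exact: pc.
    exact: norm_continuous.
  by apply: (preimage_closed (f := fun z : T => `|z k.+1 - z k|) (D := [set x | x <= d]));
    [move=> x _; exact: c|exact: closed_le].
have cE : continuous (energy f m : T -> R).
  apply: continuous_big => [|k _ z]; first exact: add_continuous.
  apply: (@continuous_comp _ _ _ (fun z : T => f (z k.+1) - f (z k)) (@sqn n)).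
    by apply: continuousB; apply: continuous_comp;
      [exact: pc|exact: cf|exact: pc|exact: cf].
  exact: sqn_continuous.
have [z zA zmin] := @compact_EVT_min T R _ (chain P Q r d m : set T) A0 cA
  (continuous_subspaceT cE).
exists z; first by rewrite inE in zA.
by move=> y yA; apply: zmin; rewrite inE.
Qed.

(** When all constraints are strict, an inner point can be moved in every
    direction, so that [critical_midpoint] applies to it. *)
Lemma minimizer_straight n (f : 'rV[R]_n -> 'rV[R]_n) (P Q : 'rV[R]_n) r d m z :
  (forall x, differentiable f x) -> (forall x, 'J f x \in unitmx) ->
  chain P Q r d m z ->
  (forall y, chain P Q r d m y -> energy f m z <= energy f m y) ->
  (forall k, `|z k - P| < r) -> (forall k, `|z k.+1 - z k| < d) ->
  forall k, (k.+1 < m)%N -> f (z k.+1) - f (z k) = f (z k.+2) - f (z k.+1).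
Proof.
move=> df Ju [z0 zm _ _] zmin zr zd k km.
apply: critical_midpoint => // w.
have [c cE] := energy_update f z km.
pose e := Num.min (r - `|z k.+1 - P|)
  (Num.min (d - `|z k.+1 - z k|) (d - `|z k.+2 - z k.+1|)).
have e0 : 0 < e by rewrite !lt_min !subr_gt0 zr !zd.
near=> t.
have : `|t *: w| <= e.
  rewrite normrZ.
  have : `|t| <= e / (`|w| + 1).
    near: t; apply/nbhs_ballP; exists (e / (`|w| + 1)) => /=.
      by rewrite divr_gt0// ltr_wpDl.
    by move=> t; rewrite -ball_normE /= sub0r normrN => /ltW.
  rewrite ler_pdivlMr ?ltr_wpDl// => h; apply: le_trans h.
  by rewrite ler_wpM2l// lerDl.
rewrite !le_min => /and3P[h1 h2 h3].
suff /zmin : chain P Q r d m (update z k.+1 (z k.+1 + t *: w)).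
  by rewrite -{1}(update_id z k.+1) !cE lerD2l.
split => [|j mj|j|j]; rewrite /update.
- by rewrite z0.
- by rewrite gtn_eqF ?zm// (leq_trans km).
- case: eqP => [_|_]; last exact: ltW.
  by rewrite addrAC (le_trans (ler_normD _ _))//; lra.
- rewrite eqSS; case: eqP => [->|_]; case: eqP => [E|_]; last exact: ltW.
  + by move: E => /eqP; rewrite ltn_eqF.
  + by rewrite addrAC (le_trans (ler_normD _ _))//; lra.
  + by rewrite E opprD addrA (le_trans (ler_normB _ _))//; lra.
Unshelve. all: by end_near. Qed.

Lemma expanding_jacobian_unit n (f : 'rV[R]_n -> 'rV[R]_n) (a : R) (z : 'rV[R]_n) :
  0 < a -> (forall w : 'rV[R]_n, a * `|w| <= `|w *m 'J f z|) -> 'J f z \in unitmx.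
Proof.
move=> a0 h; rewrite -row_free_unit -kermx_eq0; apply/rowV0P => v /sub_kermxP vJ.
have := h v; rewrite vJ normr0 pmulr_rle0// normr_le0 => /eqP //.
Qed.

Lemma C1_local_lipschitz n (f : 'rV[R]_n -> 'rV[R]_n) (K : set 'rV[R]_n) :
  C1 f -> compact K ->
  exists d M : R, [/\ 0 < d, 0 < M & forall z, K z -> forall w, `|w| <= d ->
    `|f (z + w) - f z| <= M * `|w|].
Proof.
move=> fC cK; have [d d0 hd] := C1_uniformly_differentiable fC cK (@ltr01 R).
have : bounded_set ((fun z => 'J f z) @` K).
  apply: compact_bounded; apply: continuous_compact => //.
  by apply: continuous_subspaceT; exact: fC.2.
move=> /ex_strict_bound_gt0[M M0 hM].
exists d, (n%:R * M + 1); split => //; first by rewrite ltr_wpDl// mulr_ge0// ltW.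
move=> z Kz w wd; rewrite -[X in `|X|](subrK (w *m 'J f z)).
rewrite (le_trans (ler_normD _ _))// addrC mulrDl lerD//; last exact: hd.
rewrite (le_trans (norm_mulmx_le _ _))// ler_wpM2r// ler_wpM2l//.
by apply: ltW; apply: hM; exists z.
Qed.

Lemma C1_local_expanding n (f : 'rV[R]_n -> 'rV[R]_n) (K : set 'rV[R]_n) (a b : R) :
  C1 f -> compact K -> b < a -> (forall z w : 'rV[R]_n, a * `|w| <= `|w *m 'J f z|) ->
  exists2 d, 0 < d & forall z, K z -> forall w, `|w| <= d ->
    b * `|w| <= `|f (z + w) - f z|.
Proof.
move=> fC cK ba h.
have [|d d0 hd] := @C1_uniformly_differentiable _ _ _ f K (a - b) fC cK.
  by rewrite subr_gt0.
exists d => // z Kz w wd.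
have h1 := hd z Kz w wd; have h2 := h z w.
have : `|w *m 'J f z| <= `|f (z + w) - f z| + `|f (z + w) - f z - w *m 'J f z|.
  have {1}-> : w *m 'J f z = (f (z + w) - f z) - (f (z + w) - f z - w *m 'J f z).
    by rewrite opprB addrC subrK.
  exact: ler_normB.
by move=> h3; rewrite mulrBl in h1; lra.
Qed.

(** A competitor for the energy: equally spaced points on the segment. *)
Lemma segment_chain n (P Q : 'rV[R]_n) r d m : (0 < m)%N ->
  `|Q - P| <= r -> `|Q - P| <= m%:R * d -> 0 <= d ->
  exists2 y, chain P Q r d m y &
    forall k, `|y k - P| <= `|Q - P| /\ `|y k.+1 - y k| <= `|Q - P| / m%:R.
Proof.
move=> m0 Dr Dd d0.
have m0R : 0 < m%:R :> R by rewrite ltr0n.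
pose y k := P + ((minn k m)%:R / m%:R) *: (Q - P).
have yP k : `|y k - P| <= `|Q - P|.
  rewrite /y addrC addKr normrZ ger0_norm ?divr_ge0// ler_piMl//.
  by rewrite ler_pdivrMr// mul1r ler_nat geq_minr.
have ys k : `|y k.+1 - y k| <= `|Q - P| / m%:R.
  have -> : y k.+1 - y k =
      (((minn k.+1 m)%:R - (minn k m)%:R) / m%:R) *: (Q - P).
    by rewrite mulrBl scalerBl /y opprD addrACA subrr add0r.
  rewrite normrZ mulrC ler_wpM2l// normrM [X in _ * X]gtr0_norm ?invr_gt0//.
  rewrite ler_pdivrMr// mulVf ?gt_eqF//.
  have [km|km] := leqP m k.
    by rewrite !(minn_idPr _) ?subrr ?normr0// leqW.
  have -> : minn k.+1 m = k.+1 by apply/minn_idPl.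
  have -> : k.+1%:R - k%:R = 1 :> R by rewrite -natr1 addrC addKr.
  by rewrite normr1.
exists y => //; split => [|k mk|k|k].
- by rewrite /y min0n mul0r scale0r addr0.
- by rewrite /y (minn_idPr mk) divff ?gt_eqF// scale1r addrC subrK.
- exact: le_trans Dr.
- by rewrite (le_trans (ys k))// ler_pdivrMr// mulrC.
Qed.

(** A quantitative Hadamard theorem.  The competitor of [segment_chain] has
    energy at most L ^ 2 / m for an L that does not depend on m, while a local
    expansion by b makes every step of the minimiser at most
    L / (b sqrt m) and its length at most L / b; for m large no constraint is
    active, and [minimizer_straight] makes the images of the steps all equal. *)
Theorem expanding_distances n (f : 'rV[R]_n -> 'rV[R]_n) (a b : R) (P Q : 'rV[R]_n) :
  C1 f -> 0 < b -> b < a ->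
  (forall z w : 'rV[R]_n, a * `|w| <= `|w *m 'J f z|) ->
  b * `|Q - P| <= `|f Q - f P|.
Proof.
move=> fC b0 ba fa.
set D := `|Q - P|.
have D0 : 0 <= D by exact: normr_ge0.
have [d0 [M [d00 M0 hM]]] :=
  C1_local_lipschitz fC (closed_ball_compact (P := P) (r := D)).
pose L := n.+1%:R * (M * D) + 1.
have MD0 : 0 <= M * D by rewrite mulr_ge0// ltW.
have L0 : 0 < L by rewrite ltr_wpDl// mulr_ge0.
have nL : n%:R * (M * D) ^+ 2 <= L ^+ 2.
  have : n%:R * (M * D) ^+ 2 <= (n.+1%:R * (M * D)) ^+ 2.
    rewrite [leRHS]exprMn ler_wpM2r ?sqr_ge0// -natrX ler_nat.
    by rewrite (leq_trans (leqnSn n))// -mulnn leq_pmull.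
  have x0 : 0 <= n.+1%:R * (M * D) by rewrite mulr_ge0.
  by move/le_trans; apply; rewrite ler_sqr ?nnegrE ?(ltW L0)// lerDl.
(* L / b bounds the length of the minimiser; D makes room for the segment. *)
pose r := L / b + 1 + D.
have Lb0 : 0 < L / b by rewrite divr_gt0.
have Dr : D < r by rewrite /r; lra.
have [d d_gt0 hd] :=
  C1_local_expanding fC (closed_ball_compact (P := P) (r := r)) ba fa.
(* The three terms make the steps of the competitor short enough for the
   Lipschitz bound and for the chain, and those of the minimiser shorter
   than d. *)
pose B := D / d0 + D / d + L ^+ 2 / (b * d) ^+ 2.
pose m := (Num.bound B).+1.
have bd0 : 0 < (b * d) ^+ 2 by rewrite exprn_gt0// mulr_gt0.
have [B1 B2 B3] : [/\ 0 <= D / d0, 0 <= D / d & 0 <= L ^+ 2 / (b * d) ^+ 2].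
  by split; apply: divr_ge0; rewrite ?sqr_ge0// ltW.
have Bm : B < m%:R.
  have B0 : 0 <= B by rewrite !addr_ge0.
  by rewrite (lt_trans (archi_boundP B0))// ltr_nat.
have m0 : (0 < m)%N by [].
have mR0 : 0 < m%:R :> R by rewrite ltr0n.
have Dm0 : D / m%:R <= d0.
  rewrite ler_pdivrMr// mulrC -ler_pdivrMr//; move: Bm; rewrite /B; lra.
have Dm : D <= m%:R * d by rewrite -ler_pdivrMr//; move: Bm; rewrite /B; lra.
have Lm : L ^+ 2 / m%:R < (b * d) ^+ 2.
  rewrite ltr_pdivrMr// mulrC -ltr_pdivrMr//; move: Bm; rewrite /B; lra.
have [y yc yD] := segment_chain m0 (ltW Dr) Dm (ltW d_gt0).
have cf : continuous f by move=> x; apply: differentiable_continuous; exact: fC.1.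
have [z zc zmin] : exists2 z, chain P Q r d m z &
    forall y, chain P Q r d m y -> energy f m z <= energy f m y.
  by apply: energy_minimizer => //; exists y.
pose v k := f (z k.+1) - f (z k).
have Ez : energy f m z <= L ^+ 2 / m%:R.
  apply: le_trans (zmin _ yc) _.
  have : energy f m y <= \sum_(k < m) n%:R * (M * (D / m%:R)) ^+ 2.
    apply: ler_sum => k _; rewrite (le_trans (sqn_le_norm2 _))// ler_wpM2l//.
    rewrite ler_sqr ?nnegrE ?mulr_ge0 ?(ltW M0) ?divr_ge0//.
    have [y1 y2] := yD k.
    have := hM (y k) y1 (y k.+1 - y k) (le_trans y2 Dm0).
    rewrite [y k + _]addrC subrK => /le_trans; apply.
    by rewrite ler_wpM2l// ltW.
  move/le_trans; apply; rewrite sumr_const card_ord -[_ *+ m]mulr_natl.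
  have -> : m%:R * (n%:R * (M * (D / m%:R)) ^+ 2) = n%:R * (M * D) ^+ 2 / m%:R.
    by field; rewrite gt_eqF.
  by apply: ler_wpM2r; [rewrite invr_ge0 ltW|exact: nL].
have [z0 zm zr zd] := zc.
have vstep k : b * `|z k.+1 - z k| <= `|v k|.
  have := hd (z k) (zr k) (z k.+1 - z k) (zd k).
  by rewrite [z k + _]addrC subrK.
have zd' k : `|z k.+1 - z k| < d.
  have [mk|km] := leqP m k; first by rewrite !zm ?subrr ?normr0// leqW.
  rewrite -(ltr_pM2l b0) (le_lt_trans (vstep k))//.
  rewrite -ltr_sqr ?nnegrE ?mulr_ge0// ?(ltW b0) ?(ltW d_gt0)//.
  rewrite (le_lt_trans _ (le_lt_trans Ez Lm))// (le_trans (norm2_le_sqn _))//.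
  rewrite /energy (bigD1 (Ordinal km))//= lerDl.
  by apply: sumr_ge0 => i _; exact: sqn_ge0.
have zsum i : b * `|z i - P| <= \sum_(0 <= k < i) `|v k|.
  elim: i => [|i IH]; first by rewrite big_geq// z0 subrr normr0 mulr0.
  rewrite big_nat_recr//= -[z i.+1](subrK (z i)) -addrA addrC.
  rewrite (le_trans (ler_wpM2l (ltW b0) (ler_normD _ _)))// mulrDr lerD//.
(* Cauchy-Schwarz, in the form 2 c x <= c ^ 2 + x ^ 2 with c = L / m. *)
have vsum : \sum_(0 <= k < m) `|v k| <= L.
  have : \sum_(k < m) 2 * (L / m%:R) * `|v k| <=
      \sum_(k < m) ((L / m%:R) ^+ 2 + sqn (v k)).
    apply: ler_sum => k _; have := norm2_le_sqn (v k).
    have := sqr_ge0 (L / m%:R - `|v k|); nra.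
  rewrite -mulr_sumr big_split/= sumr_const card_ord.
  rewrite -[(L / m%:R) ^+ 2 *+ m]mulr_natl.
  rewrite -[X in _ + X]/(energy f m z) => h.
  have : 2 * (L / m%:R) * \sum_(k < m) `|v k| <= 2 * (L / m%:R) * L.
    apply: le_trans h _.
    have -> : m%:R * (L / m%:R) ^+ 2 = L ^+ 2 / m%:R by field; rewrite gt_eqF.
    have -> : 2 * (L / m%:R) * L = L ^+ 2 / m%:R + L ^+ 2 / m%:R.
      by field; rewrite gt_eqF.
    by rewrite lerD2l.
  by rewrite big_mkord ler_pM2l// mulr_gt0// divr_gt0.
have zr' i : `|z i - P| < r.
  have [mi|im] := leqP m i; first by rewrite zm.
  rewrite (le_lt_trans _ (_ : L / b < r))//; last by rewrite /r; lra.
  rewrite ler_pdivlMr// mulrC (le_trans (zsum i))// (le_trans _ vsum)//.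
  have -> : \sum_(0 <= k < m) `|v k| =
      \sum_(0 <= k < i) `|v k| + \sum_(i <= k < m) `|v k|.
    by rewrite -big_cat_nat// ltnW.
  by rewrite lerDl; apply: sumr_ge0.
have Ju x : 'J f x \in unitmx.
  apply: (@expanding_jacobian_unit _ _ a) => //; exact: lt_trans ba.
have straight := minimizer_straight fC.1 Ju zc zmin zr' zd'.
have vconst k : (k < m)%N -> v k = v 0%N.
  elim: k => [//|k IH km]; rewrite -IH; last exact: ltnW.
  by rewrite /v -straight.
have := zsum m; rewrite zm// -/D => /le_trans; apply.
have -> : f Q - f P = \sum_(0 <= k < m) v k by rewrite telescope_sumr// zm// z0.
rewrite (eq_big_nat _ _ (F2 := fun=> `|v 0%N|)); last first.
  by move=> k /andP[_ km]; rewrite vconst.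
rewrite [in leRHS](eq_big_nat _ _ (F2 := fun=> v 0%N)); last first.
  by move=> k /andP[_ km]; rewrite vconst.
by rewrite !sumr_const_nat subn0 normrMn.
Qed.

End discrete_geodesics.

(** * Hyperbolic diffeomorphisms of the plane *)

Section hyperbolic_maps.
Context {R : realType}.
Local Notation plane := 'rV[R]_2.

Lemma ord2P (j : 'I_2) : j = 0 \/ j = 1.
Proof. by case: j => [[|[|[]]]] // i; [left|right]; exact/val_inj. Qed.

Lemma plane_eq (u v : plane) :
  xcoord u = xcoord v -> ycoord u = ycoord v -> u = v.
Proof. by move=> ux uy; apply/rowP => j; case: (ord2P j) => ->. Qed.

Lemma enormE (u : plane) : enorm u = Num.sqrt (xcoord u ^+ 2 + ycoord u ^+ 2).
Proof.
rewrite /enorm /dot big_ord_recl big_ord1 /xcoord /ycoord !expr2.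
by have -> : lift ord0 (ord0 : 'I_1) = 1 by exact/val_inj.
Qed.

Lemma enorm_ge0 (u : plane) : 0 <= enorm u.
Proof. by rewrite enormE sqrtr_ge0. Qed.

Lemma xcoord_le (u : plane) : `|xcoord u| <= enorm u.
Proof. by rewrite enormE -sqrtr_sqr ler_wsqrtr// lerDl sqr_ge0. Qed.

Lemma ycoord_le (u : plane) : `|ycoord u| <= enorm u.
Proof. by rewrite enormE -sqrtr_sqr ler_wsqrtr// lerDr sqr_ge0. Qed.

Lemma norm_le_enorm (u : plane) : `|u| <= enorm u.
Proof.
apply: row_norm_le; first exact: enorm_ge0.
by move=> j; case: (ord2P j) => ->; [exact: xcoord_le|exact: ycoord_le].
Qed.

Lemma enorm_eq0 (u : plane) : enorm u = 0 -> u = 0.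
Proof.
by move=> h; apply/eqP; rewrite -normr_le0 (le_trans (norm_le_enorm u))// h.
Qed.

Lemma enormZ c (u : plane) : enorm (c *: u) = `|c| * enorm u.
Proof.
rewrite !enormE -sqrtr_sqr -sqrtrM ?sqr_ge0//; congr (Num.sqrt _).
by rewrite /xcoord /ycoord !mxE; ring.
Qed.

Lemma xconeE l (u : plane) : cone (mkpoint 1 0) l u = (l * enorm u <= `|xcoord u|).
Proof.
rewrite /cone /= /dot big_ord_recl big_ord1 !mxE /= mulr1 mulr0 addr0.
by [].
Qed.

Lemma yconeE l (u : plane) : cone (mkpoint 0 1) l u = (l * enorm u <= `|ycoord u|).
Proof.
rewrite /cone /= /dot big_ord_recl big_ord1 !mxE /= mulr1 mulr0 add0r.
by have -> : lift ord0 (ord0 : 'I_1) = 1 by exact/val_inj.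
Qed.

Definition expands_cone (K : plane -> set plane) (L : R) (f : plane -> plane) :=
  forall P u, K P u -> K (f P) ('d f P u) /\ L * enorm u <= enorm ('d f P u).

(** The inverse g is part of the data, which makes the notion symmetric: the
    inverse expands the other family of cones. *)
Definition hyperbolic (Ku Ks : plane -> set plane) (L : R) (f g : plane -> plane) :=
  [/\ cancel f g, cancel g f, C1 f & C1 g] /\
  (expands_cone Ku L f /\ expands_cone Ks L g).

Lemma hyperbolic_sym Ku Ks L f g :
  hyperbolic Ku Ks L f g -> hyperbolic Ks Ku L g f.
Proof. by case=> -[? ? ? ?] [? ?]. Qed.

Lemma expands_cone_comp K L1 L2 f1 f2 : 0 <= L2 ->
  (forall z, differentiable f1 z) -> (forall z, differentiable f2 z) ->
  expands_cone K L1 f1 -> expands_cone K L2 f2 ->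
  expands_cone K (L2 * L1) (f2 \o f1).
Proof.
move=> L20 df1 df2 h1 h2 P u Ku; have [Ku1 e1] := h1 P u Ku.
have [Ku2 e2] := h2 _ _ Ku1.
have E := diff_compE u (df1 P) (df2 (f1 P)).
split; first by rewrite E.
by rewrite E (le_trans _ e2)// -mulrA ler_wpM2l.
Qed.

Lemma hyperbolic_comp Ku Ks L1 L2 f1 g1 f2 g2 : 0 <= L1 -> 0 <= L2 ->
  hyperbolic Ku Ks L1 f1 g1 -> hyperbolic Ku Ks L2 f2 g2 ->
  hyperbolic Ku Ks (L2 * L1) (f2 \o f1) (g1 \o g2).
Proof.
move=> L10 L20 [[fg1 gf1 Cf1 Cg1] [e1 c1]] [[fg2 gf2 Cf2 Cg2] [e2 c2]].
split; first split.
- by move=> z /=; rewrite fg2.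
- by move=> z /=; rewrite gf1.
- exact: C1_comp.
- exact: C1_comp.
split; first by apply: expands_cone_comp => //; [exact: Cf1.1|exact: Cf2.1].
by rewrite mulrC; apply: expands_cone_comp => //; [exact: Cg2.1|exact: Cg1.1].
Qed.

Lemma hyperbolic_id Ku Ks : hyperbolic Ku Ks 1 id id.
Proof.
have h K : expands_cone K 1 id.
  by move=> P u Ku'; rewrite diff_val mul1r.
by split; [split => //; exact: C1_id|split].
Qed.

(** The composition of the branches read along s over N steps, together with
    its inverse, is as hyperbolic as N iterates of one map.  It does not depend
    on the orbit: all orbits that follow s for N steps are moved by it. *)
Lemma hyperbolic_orbit Ku Ks L (f g : bool -> plane -> plane) : 0 <= L ->
  (forall b, hyperbolic Ku Ks L (f b) (g b)) ->
  forall (s : nat -> bool) N, exists2 h, exists k, hyperbolic Ku Ks (L ^+ N) h k &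
    forall z : nat -> plane,
      (forall i, (i < N)%N -> z i.+1 = f (s i) (z i)) -> h (z 0%N) = z N.
Proof.
move=> L0 H s; elim => [|N [h [k hk] hz]].
  by exists id => //; exists id; exact: hyperbolic_id.
exists (f (s N) \o h); first exists (k \o g (s N)).
  by rewrite exprS; exact: (hyperbolic_comp (exprn_ge0 N L0) L0 hk (H (s N))).
move=> z zf /=; rewrite hz ?zf// => i iN.
by apply: zf; exact: leqW.
Qed.

Lemma diff_cancel (f g : plane -> plane) z w : cancel f g ->
  differentiable f z -> differentiable g (f z) -> 'd g (f z) ('d f z w) = w.
Proof.
move=> fg df dg; rewrite -diff_compE//.
have -> : g \o f = id by apply/funext.
by rewrite diff_val.
Qed.

(** A vector of the first cone is not vertical, so a parallel vector is a
    multiple of it, lies in both cones, and vanishes by disjointness. *)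
Lemma cone_frame_independent (Ku Ks : set plane) (u v : plane) :
  universal_pair Ku Ks -> Ku u -> Ks v -> u != 0 -> v != 0 ->
  xcoord u * ycoord v - ycoord u * xcoord v != 0.
Proof.
move=> [lu [ls [/andP[lu0 _] _ -> -> disj]]]; rewrite xconeE => Ku' Ks' u0 v0.
apply/eqP => D0.
have ux0 : xcoord u != 0.
  apply: contraNneq u0 => ux; apply/eqP/enorm_eq0/eqP; rewrite eq_le enorm_ge0 andbT.
  by rewrite -(pmulr_rle0 _ lu0) (le_trans Ku')// ux normr0.
have E : v = (xcoord v / xcoord u) *: u.
  apply: plane_eq; rewrite /xcoord /ycoord !mxE -/(xcoord u) -/(ycoord u) -/(xcoord v).
    by rewrite divfK.
  rewrite -/(ycoord v); apply: (mulfI ux0).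
  have -> : xcoord u * ycoord v = ycoord u * xcoord v.
    by apply/eqP; rewrite -subr_eq0 D0.
  by field.
have : [set 0] v.
  rewrite -disj; split => //; rewrite xconeE E enormZ.
  move: (_ / _) => c; rewrite [xcoord (_ *: _)]mxE -/(xcoord u).
  by rewrite normrM mulrCA ler_wpM2l.
by move=> v0'; rewrite v0' eqxx in v0.
Qed.

(** What the estimates use of two cone fields inside a universal pair, with the
    same coefficient l for both axes. *)
Definition transverse (l : R) (Ku Ks : plane -> set plane) : Prop :=
  [/\ forall P u, Ku P u -> l * enorm u <= `|xcoord u|,
      forall P s, Ks P s -> l * enorm s <= `|ycoord s|,
      forall P u s, Ku P u -> Ks P s -> u != 0 -> s != 0 ->
        xcoord u * ycoord s - ycoord u * xcoord s != 0,
      forall P, exists2 u, u != 0 & Ku P u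
    & forall P, exists2 s, s != 0 & Ks P s].

Lemma frame_decomposition (u v w : plane) :
  xcoord u * ycoord v - ycoord u * xcoord v != 0 ->
  exists a b, w = a *: u + b *: v.
Proof.
set D := _ - _ => D0.
exists ((xcoord w * ycoord v - ycoord w * xcoord v) / D),
  ((xcoord u * ycoord w - ycoord u * xcoord w) / D).
by apply: plane_eq; rewrite /xcoord /ycoord !mxE; move: D0;
  rewrite /D /xcoord /ycoord => D0; field.
Qed.

(** Write w = a u + b s, where u is pulled back by f' from a vector of Ku at
    f' z, and s is pulled back by f from a vector of Ks at f z.  Then f stretches
    u and shrinks s by L, and f' the other way round; the cone conditions on
    the images of u and s bound the coordinates from below. *)
Lemma hyperbolic_cross (Ku Ks : plane -> set plane) L l
    (f g f' g' : plane -> plane) (z w : plane) :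
  transverse l Ku Ks -> 0 <= l -> 0 < L -> 0 <= l * L - L^-1 ->
  hyperbolic Ku Ks L f g -> hyperbolic Ks Ku L f' g' ->
  (l * L - L^-1) * `|w| <= `|xcoord ('d f z w)| + `|ycoord ('d f' z w)|.
Proof.
move=> [Kx Ky indep Ku0 Ks0] l0 L0 lL.
move=> [[fg gf [df _] [dg _]] [ef eg]] [[fg' gf' [df' _] [dg' _]] [ef' eg']].
have [u0 u0_neq0 Ku0'] := Ku0 (f' z).
have [s0 s0_neq0 Ks0'] := Ks0 (f z).
pose u := 'd g' (f' z) u0; pose s := 'd g (f z) s0.
have [Ku_u Lu] : Ku z u /\ L * enorm u0 <= enorm u.
  by have := eg' _ _ Ku0'; rewrite fg'.
have [Ks_s Ls] : Ks z s /\ L * enorm s0 <= enorm s.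
  by have := eg _ _ Ks0'; rewrite fg.
have fu : 'd f' z u = u0.
  by have := diff_cancel u0 gf' (dg' (f' z)) (df' _); rewrite fg'; apply; rewrite -?fg'.
have fs : 'd f z s = s0.
  by have := diff_cancel s0 gf (dg (f z)) (df _); rewrite fg; apply; rewrite -?fg.
have u_neq0 : u != 0 by apply: contraNneq u0_neq0 => u00; rewrite -fu u00 linear0.
have s_neq0 : s != 0 by apply: contraNneq s0_neq0 => s00; rewrite -fs s00 linear0.
have [a [b wE]] := frame_decomposition w
  (indep z u s Ku_u Ks_s u_neq0 s_neq0).
have xD (p q : plane) (c d : R) :
    xcoord (c *: p + d *: q) = c * xcoord p + d * xcoord q.
  by rewrite /xcoord !mxE.
have yD (p q : plane) (c d : R) :
    ycoord (c *: p + d *: q) = c * ycoord p + d * ycoord q.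
  by rewrite /ycoord !mxE.
have dw : 'd f z w = a *: 'd f z u + b *: s0.
  by rewrite wE linearD !linearZ /= fs.
have dw' : 'd f' z w = a *: u0 + b *: 'd f' z s.
  by rewrite wE linearD !linearZ /= fu.
have [Ku_fu Lfu] := ef z u Ku_u; have [Ks_fs Lfs] := ef' z s Ks_s.
have X : `|a| * (l * L * enorm u) - `|b| * (L^-1 * enorm s) <= `|xcoord ('d f z w)|.
  rewrite dw xD; apply: le_trans (lerB_normD _ _); rewrite !normrM lerB//.
    rewrite ler_wpM2l// (le_trans _ (Kx _ _ Ku_fu))// -mulrA ler_wpM2l//.
  rewrite ler_wpM2l// (le_trans (xcoord_le _))// mulrC ler_pdivlMr// mulrC//.
have Y : `|b| * (l * L * enorm s) - `|a| * (L^-1 * enorm u) <= `|ycoord ('d f' z w)|.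
  rewrite dw' yD [a * _ + _]addrC; apply: le_trans (lerB_normD _ _).
  rewrite !normrM lerB//.
    rewrite ler_wpM2l// (le_trans _ (Ky _ _ Ks_fs))// -mulrA ler_wpM2l//.
  rewrite ler_wpM2l// (le_trans (ycoord_le _))// mulrC ler_pdivlMr// mulrC//.
have wn : `|w| <= `|a| * enorm u + `|b| * enorm s.
  rewrite wE (le_trans (ler_normD _ _))// !normrZ lerD// ler_wpM2l// norm_le_enorm//.
apply: le_trans (lerD X Y); apply: le_trans (ler_wpM2l lL wn) _.
rewrite le_eqVlt; apply/orP; left; apply/eqP; ring.
Qed.

(** The map (x o f, y o f'), written with the two coordinate projections as
    matrices so that its Jacobian is computed by the rules for C1 maps. *)
Definition axis_pair (f f' : plane -> plane) : plane -> plane :=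
  ((fun z => z *m delta_mx 0 0) \o f) + ((fun z => z *m delta_mx 1 1) \o f').

Lemma C1_axis_pair f f' : C1 f -> C1 f' -> C1 (axis_pair f f').
Proof.
move=> Cf Cf'.
exact: (C1_add (C1_comp Cf (C1_mulmxr _)) (C1_comp Cf' (C1_mulmxr _))).
Qed.

Lemma axis_projections (u v : plane) :
  let p := u *m delta_mx 0 0 + v *m delta_mx 1 1 in
  xcoord p = xcoord u /\ ycoord p = ycoord v.
Proof.
have E : lift ord0 (ord0 : 'I_1) = 1 :> 'I_2 by exact/val_inj.
rewrite /xcoord /ycoord !mxE !big_ord_recl !big_ord0 !mxE /= E.
by rewrite !(mulr0, mulr1, addr0, add0r).
Qed.

Lemma diff_axis_pair f f' z w : C1 f -> C1 f' ->
  'd (axis_pair f f') z w =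
  'd f z w *m delta_mx 0 0 + 'd f' z w *m delta_mx 1 1.
Proof.
move=> Cf Cf'.
have half (h : plane -> plane) (A : 'M[R]_2) : C1 h ->
    differentiable ((fun z : plane => z *m A) \o h) z /\
    'd ((fun z : plane => z *m A) \o h) z w = 'd h z w *m A.
  move=> Ch; have [dA EA] := is_diff_mulmxr A (h z).
  split; first by apply: differentiable_comp => //; exact: Ch.1.
  apply: etrans (diff_compE w (Ch.1 z) dA) _.
  exact: (congr1 (fun k : plane -> plane => k ('d h z w)) EA).
have [d1 E1] := half f (delta_mx 0 0) Cf.
have [d2 E2] := half f' (delta_mx 1 1) Cf'.
have E := congr1 (fun h : plane -> plane => h w) (diffD d1 d2).
apply: etrans E _.
by apply: (f_equal2 (fun a b : plane => a + b)); [exact: E1|exact: E2].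
Qed.

(** A vector whose two coordinates have absolute values of sum at least
    c |w| has sup norm at least c / 2 |w|; the second factor 2 is the room
    between a and b in [expanding_distances]. *)
Lemma hyperbolic_expansive (Ku Ks : plane -> set plane) L l
    (f g f' g' : plane -> plane) (P Q : plane) C :
  transverse l Ku Ks -> 0 <= l -> 0 < L -> 0 < l * L - L^-1 ->
  hyperbolic Ku Ks L f g -> hyperbolic Ks Ku L f' g' ->
  `|f Q - f P| <= C -> `|f' Q - f' P| <= C ->
  (l * L - L^-1) * `|Q - P| <= 4 * C.
Proof.
move=> tr l0 L0 c0 hf hf' fC fC'.
set c := l * L - L^-1 in c0 *.
have [[_ _ Cf _] _] := hf; have [[_ _ Cf' _] _] := hf'.
have CP := C1_axis_pair Cf Cf'.
have b0 : 0 < c / 4 by rewrite divr_gt0.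
have ba : c / 4 < c / 2 by rewrite ltr_pM2l// ltf_pV2 ?posrE// ltr_nat.
have := @expanding_distances R 2 (axis_pair f f') (c / 2) (c / 4) P Q CP b0 ba.
have expands : forall z w : plane, c / 2 * `|w| <= `|w *m 'J (axis_pair f f') z|.
  move=> z w.
  have cross := hyperbolic_cross z w tr l0 L0 (ltW c0) hf hf'.
  have <- : 'd (axis_pair f f') z w = w *m 'J (axis_pair f f') z.
    exact: diff_jacobian.
  rewrite diff_axis_pair//.
  move: cross; have [<- <-] := axis_projections ('d f z w) ('d f' z w).
  set p := (_ *m _ + _ *m _); rewrite -/c => cross.
  have := entry_le_norm p 0 0; have := entry_le_norm p 0 1.
  move: cross; rewrite /xcoord /ycoord; lra.
move=> /(_ expands) h.
have : `|axis_pair f f' Q - axis_pair f f' P| <= C.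
  have C0 : 0 <= C by apply: le_trans fC.
  rewrite /axis_pair !fctE /= opprD addrACA -!mulmxBl.
  have [px py] := axis_projections (f Q - f P) (f' Q - f' P).
  apply: row_norm_le => // j; case: (ord2P j) => ->.
    by rewrite -/(xcoord _) px (le_trans (entry_le_norm _ _ _)).
  by rewrite -/(ycoord _) py (le_trans (entry_le_norm _ _ _)).
by move: h; lra.
Qed.

End hyperbolic_maps.

(** * The divider, the half-planes and the orbits in the attractor *)

Section half_planes.
Context {R : realType}.
Local Notation plane := 'rV[R]_2.

Definition graph_point (g : R -> R) (y : R) : plane := mkpoint (g y) y.

(** The second coordinate of the parametrised curve is the identity, so the
    velocity is never zero. *)
Lemma diff_graph_point (g : R -> R) (y : R) : derivable g y 1 ->
  differentiable (graph_point g) y /\ ycoord ('d (graph_point g) y 1) = 1.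
Proof.
move=> /derivable1_diffP dg.
have d1 : differentiable (fun y => g y *: mkpoint 1 0 : plane) y.
  exact: differentiableZl.
have d2 : differentiable (fun y : R => y *: mkpoint 0 1 : plane) y.
  by have [] := is_diff_scalel y (mkpoint 0 1 : plane).
have E : graph_point g =
    (fun y => g y *: mkpoint 1 0 : plane) + (fun y : R => y *: mkpoint 0 1 : plane).
  apply/funext => s; rewrite !fctE; apply: plane_eq;
    by rewrite /xcoord /ycoord !mxE /= !(mulr0, mulr1, addr0, add0r).
have dgp : differentiable (graph_point g) y.
  by rewrite E; exact: differentiableD.
split => //; have dy := is_derive_coord 1 dgp.
have yE : (fun s => graph_point g s 0 1) = id by apply/funext => s; rewrite !mxE.
rewrite yE in dy.
have := @derive_val _ _ _ _ _ _ _ dy; rewrite derive_id => e.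
exact: esym e.
Qed.

(** The velocity of the image curve is a nonzero tangent vector, so it is in a
    cone around the horizontal axis and its first coordinate does not vanish.
    By Rolle's theorem the first coordinate is injective along the curve. *)
Lemma image_graph_single_valued (f k : plane -> plane) (G : set plane)
    (K : plane -> set plane) (l : R) :
  cancel f k -> (forall z, differentiable f z) -> (forall z, differentiable k z) ->
  infinite_vertical_curve G -> 0 < l ->
  (forall P u, K P u -> l * enorm u <= `|xcoord u|) ->
  (forall P, G P -> forall v, tangent_vector (f @` G) (f P) v -> K (f P) v) ->
  forall A B, (f @` G) A -> (f @` G) B -> xcoord A = xcoord B -> A = B.
Proof.
move=> fk df dk [g [dg _ GE]] l0 Kl Gtan.
pose c := f \o graph_point g.
have dc y : differentiable c y.
  by apply: differentiable_comp; [have [] := diff_graph_point (dg y)|].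
have Gc y : G (graph_point g y).
  by rewrite GE /= /xcoord /ycoord !mxE.
have cx_neq0 y : xcoord ('d c y 1) != 0.
  have [dgp yw'] := diff_graph_point (dg y).
  have [w0 w0E yw] : exists2 w0, 'd (graph_point g) y 1 = w0 & ycoord w0 = 1.
    by exists ('d (graph_point g) y 1).
  have [v vE' vE] : exists2 v, v = 'd c y 1 & v = 'd f (graph_point g y) w0.
    exists ('d c y 1) => //; rewrite -w0E.
    exact: (congr1 (fun h : R -> plane => h 1) (diff_comp dgp (df _))).
  rewrite -vE'.
  have v0 : v != 0.
    apply/eqP => v0.
    have e : 'd k (f (graph_point g y)) v = w0.
      apply: etrans (diff_cancel w0 fk (df (graph_point g y)) (dk _)).
      exact: (congr1 _ vE).
    have w00 : w0 = 0 by rewrite -e v0 linear0.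
    have : ycoord w0 = 0 by rewrite w00 /ycoord mxE.
    by rewrite yw => /eqP; rewrite oner_eq0.
  have Kv : K (c y) v.
    apply: Gtan; first exact: Gc.
    exists (fun t => c (t + y)); split; first by rewrite add0r.
      by apply/nbhs_ballP; exists 1 => //= t _; exists (graph_point g (t + y)).
    have ds : is_diff (0 : R) (fun t : R => t + y) (fun t => t).
      have h : is_diff (0 : R) (id + cst y) (id + 0) by apply: is_diffD.
      by rewrite addr0 in h.
    have dcs : is_diff (0 : R) (fun t => c (t + y)) ('d c y).
      have dcy : is_diff (0 + y) c ('d c y).
        by rewrite add0r; apply: differentiableP.
      exact: (@is_diff_comp _ _ _ _ _ _ _ _ _ ds dcy).
    have [ex val] := dcs.
    apply: DeriveDef; first exact/derivable1_diffP.
    have D1 := @deriveE _ _ _ (fun t : R => c (t + y)) 0 1 ex.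
    apply: (etrans D1); rewrite vE'.
    exact: (congr1 (fun h : R -> plane => h 1) val).
  apply: contraNneq v0 => vx; apply/eqP/enorm_eq0/eqP; rewrite eq_le enorm_ge0 andbT.
  by rewrite -(pmulr_rle0 _ l0) (le_trans (Kl _ _ Kv))// vx normr0.
have inj y1 y2 : y1 < y2 -> xcoord (c y1) <> xcoord (c y2).
  move=> y12 E.
  have dx y := is_derive_coord 0 (dc y).
  have [||y3 _ d0] := @Rolle _ (fun y => c y 0 0) _ _ y12 _ _ E.
  - by move=> y _; apply: ex_derive; exact: dx.
  - apply: continuous_subspaceT => y; apply: differentiable_continuous.
    by apply/derivable1_diffP; apply: ex_derive; exact: dx.
  have := @derive_val _ _ _ _ _ _ _ (dx y3); rewrite (@derive_val _ _ _ _ _ _ _ d0).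
  by move=> /esym/eqP; apply/negP; exact: cx_neq0.
move=> _ _ [P GP <-] [Q GQ <-] E.
have onG X : G X -> X = graph_point g (ycoord X).
  by rewrite GE /= => h; apply: plane_eq; rewrite /xcoord /ycoord !mxE.
have fE X : G X -> f X = c (ycoord X) by move=> /onG h; rewrite /c /= -h.
move: E; rewrite !fE//; have [/inj|/inj h e|-> //] := ltgtP (ycoord P) (ycoord Q).
  by [].
by exfalso; apply: h.
Qed.

Lemma inv_mapK (F : plane -> plane) : injective F -> cancel F (inv_map F).
Proof.
move=> injF z; apply: injF.
exact: (@getPex _ [set P | F P = F z] (ex_intro _ z erefl)).
Qed.

Lemma inv_mapVK (F : plane -> plane) : bijective F -> cancel (inv_map F) F.
Proof.
move=> [G FG GF] z.
exact: (@getPex _ [set P | F P = z] (ex_intro _ (G z) (GF z))).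
Qed.

Lemma left_or_right (G : set plane) P :
  infinite_vertical_curve G -> left_half G P \/ right_half G P.
Proof.
move=> [g [_ _ GE]].
have GQ : G (mkpoint (g (ycoord P)) (ycoord P)).
  by rewrite GE /= /xcoord /ycoord !mxE.
have [h|h] := leP (xcoord P) (g (ycoord P)); [left|right];
  exists (mkpoint (g (ycoord P)) (ycoord P)); split => //;
  rewrite /xcoord /ycoord !mxE //=; exact: ltW.
Qed.

Lemma left_right_curve (G : set plane) P : infinite_vertical_curve G ->
  left_half G P -> right_half G P -> G P.
Proof.
move=> [g [_ _ ->]] [A [/= GA yA xA]] [B [/= GB yB xB]].
by apply/eqP; rewrite eq_le -{1}yA -GA xA -yB -GB xB.
Qed.

Definition branch (F1 F2 : plane -> plane) (b : bool) := if b then F2 else F1.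

(** On the divider both letters are allowed, and there the branches agree. *)
Lemma lozi_branch F1 F2 (G : set plane) (b : bool) P : infinite_vertical_curve G ->
  (forall Q, G Q -> F1 Q = F2 Q) ->
  (if b then right_half G P else left_half G P) ->
  lozi_map F1 F2 G P = branch F1 F2 b P.
Proof.
move=> Gc F12; rewrite /lozi_map; case: b => h; last by rewrite asboolT.
case: asboolP => // l; apply: F12; exact: left_right_curve.
Qed.

(** If F1 A = F2 B with A on the left and B off the left, the common image is
    both below and above the image of the divider, hence on it, and B would be
    on the divider. *)
Lemma lozi_injective F1 F2 (G : set plane) : infinite_vertical_curve G ->
  injective F1 -> injective F2 -> (forall Q, G Q -> F1 Q = F2 Q) ->
  F1 @` left_half G `<=` lower_half (F1 @` G) ->
  F2 @` right_half G `<=` upper_half (F2 @` G) ->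
  (forall A B, (F1 @` G) A -> (F1 @` G) B -> xcoord A = xcoord B -> A = B) ->
  injective (lozi_map F1 F2 G).
Proof.
move=> Gc inj1 inj2 F12 lower upper single.
have mixed A B : left_half G A -> ~ left_half G B -> F1 A <> F2 B.
  move=> lA nlB E; apply: (nlB).
  have rB : right_half G B by have [/nlB|] := left_or_right B Gc.
  have [X [GX xX yX]] : lower_half (F1 @` G) (F1 A) by apply: lower; exists A.
  have [Y [GY xY yY]] : upper_half (F2 @` G) (F2 B) by apply: upper; exists B.
  have GY1 : (F1 @` G) Y by case: GY => Q GQ <-; exists Q => //; exact: F12.
  have XY : X = Y by apply: single => //; rewrite xX xY E.
  have XB : X = F2 B.
    apply: plane_eq; first by rewrite xX E.
    by apply/eqP; rewrite eq_le -{2}E yX {1}XY yY.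
  case: GY => Q GQ QY; have -> : B = Q by apply: inj2; rewrite QY -XY XB.
  by exists Q.
move=> A B; rewrite /lozi_map; case: asboolP => lA; case: asboolP => lB.
- exact: inj1.
- by move/(mixed _ _ lA lB).
- by move/esym/(mixed _ _ lB lA).
- exact: inj2.
Qed.

Lemma trapping_disk_bounded F (D : set plane) : trapping_disk F D ->
  exists2 C, 0 <= C & forall X, D X -> `|X| <= C.
Proof.
move=> [_ _ [f [g [_ cg fD _ [gf _]]]]].
have disk : compact [set P : plane | enorm P <= 1].
  apply: bounded_closed_compact.
    exists 1; split => // x x1 P /= P1.
    by rewrite (le_trans (norm_le_enorm P))// (le_trans P1)// ltW.
  have -> : [set P : plane | enorm P <= 1] = (@sqn R 2) @^-1` [set x | x <= 1].
    apply/seteqP; split => P /=; rewrite /enorm;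
    have -> : dot P P = sqn P by apply: eq_bigr => j _; rewrite expr2.
      by rewrite -[X in _ <= X -> _]sqrtr1 ler_sqrt.
    by rewrite -[X in _ -> _ <= X]sqrtr1 ler_sqrt.
  apply: preimage_closed; [move=> x _; exact: sqn_continuous|exact: closed_le].
have /compact_bounded/ex_strict_bound_gt0[C C0 hC] := continuous_compact cg disk.
exists C; first exact: ltW.
move=> X DX; have cX : closure D X by exact: subset_closure.
by apply/ltW/hC; exists (f X); [apply: fD; exists X|exact: gf].
Qed.

(** The inverse of F is unspecified outside the range of F, but a point of the
    attractor has preimages of all orders in D, and injectivity says that the
    inverse finds them. *)
Lemma attractor_orbit F (D : set plane) P : injective F ->
  (forall X, D X -> D (F X)) ->
  (\bigcap_(n in [set: nat]) (iter n F @` D)) P ->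
  [/\ forall k, D (iter k F P), forall k, D (iter k (inv_map F) P)
    & forall k, F (iter k.+1 (inv_map F) P) = iter k (inv_map F) P].
Proof.
move=> injF FD PD.
have iterK k z : iter k (inv_map F) (iter k F z) = z.
  by elim: k z => [//|k IH] z; rewrite iterSr /= inv_mapK.
split=> k.
- have [z Dz /= <-] := PD 0%N I.
  by elim: k => [//|k IH]; exact: FD.
- by have [z Dz <-] := PD k I; rewrite iterK.
- by have [z Dz <-] := PD k.+1 I; rewrite iterK iterSr iterK.
Qed.

End half_planes.

(** * Points with a common window of itinerary *)

Section windows.
Context {R : realType}.
Local Notation plane := 'rV[R]_2.

Lemma diffeo_hyperbolic (F : plane -> plane) lam (Ku Ks : set plane) KuP KsP :
  C1_diffeo F -> cones_invariant F Ku Ks KuP KsP ->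
  cones_stretched F lam KuP KsP -> hyperbolic KuP KsP lam F (inv_map F).
Proof.
move=> [bF CF CG] inv str; split.
  exact: And4 (inv_mapK (bij_inj bF)) (inv_mapVK bF) CF CG.
split=> P u Ku'; have [s1 s2] := str P; have [_ _ i1 i2] := inv P.
  by split; [apply: i1; exists u|exact: s1].
by split; [apply: i2; exists u|exact: s2].
Qed.

Lemma cone_field_nonzero (K : plane -> set plane) P : cone_field K ->
  exists2 u, u != 0 & K P u.
Proof.
move=> [v [l [_ _ v1 l01 KE]]]; exists (v P).
  apply/eqP => v0; have := v1 P.
  rewrite v0 enormE /xcoord /ycoord !mxE expr0n addr0 sqrtr0 => /eqP.
  by rewrite eq_sym oner_eq0.
rewrite KE /cone /= v1 mulr1.
have dv : dot (v P) (v P) = 1.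
  have d0 : 0 <= dot (v P) (v P).
    by apply: sumr_ge0 => j _; rewrite -expr2 sqr_ge0.
  by rewrite -(sqr_sqrtr d0) -/(enorm _) v1 expr1n.
by rewrite dv normr1; case/andP: (l01 P) => _ /ltW.
Qed.

Lemma expr_unbounded (x M : R) : 1 < x -> exists N, M < x ^+ N.
Proof.
move=> x1.
have bern N : 1 + N%:R * (x - 1) <= x ^+ N.
  elim: N => [|N IH]; first by rewrite mul0r addr0 expr0.
  rewrite exprS; apply: le_trans (_ : x * (1 + N%:R * (x - 1)) <= _); last first.
    by rewrite ler_wpM2l// (le_trans _ (ltW x1)).
  have N0 : 0 <= N%:R :> R by exact: ler0n.
  by have := mulr_ge0 N0 (sqr_ge0 (x - 1)); rewrite -natr1; lra.
have x10 : 0 < x - 1 by rewrite subr_gt0.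
have := archi_boundP (normr_ge0 (M / (x - 1))).
set N := Num.bound _ => hN; exists N.
apply: lt_le_trans (bern N); apply: lt_le_trans (_ : N%:R * (x - 1) <= _); last by lra.
by rewrite -ltr_pdivrMr// (le_lt_trans (ler_norm _)).
Qed.

Lemma window_near (p : {ptws int -> bool}) N :
  \forall q \near p, forall k, (k < N)%N ->
    q (Posz k) = p (Posz k) /\ q (Negz k) = p (Negz k).
Proof.
have coord (n : int) : \forall q \near p, q n = p n.
  have := @proj_continuous int (fun=> bool) n p [set p n].
  by apply; rewrite /=; exact: discrete_set1.
suff : \forall q \near p, forall k : 'I_N,
    q (Posz k) = p (Posz k) /\ q (Negz k) = p (Negz k).
  by apply: filterS => q h k kN; exact: (h (Ordinal kN)).
apply: (@filter_forall _ _ _ (nbhs p)) => k.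
by apply: filterI; exact: coord.
Qed.

Lemma universal_transverse (U S : set plane) (KuP KsP : plane -> set plane) :
  universal_pair U S -> cone_field KuP -> cone_field KsP ->
  (forall P, KuP P `<=` U) -> (forall P, KsP P `<=` S) ->
  exists2 l, 0 < l & transverse l KuP KsP.
Proof.
move=> US cfu cfs KuU KsS.
have [lu [ls [/andP[lu0 _] /andP[ls0 _] UE SE _]]] := US.
exists (Num.min lu ls); first by rewrite lt_min lu0.
split=> [P u /KuU|P s /KsS|P u s /KuU Uu /KsS Ss|P|P].
- rewrite UE xconeE; apply: le_trans.
  by rewrite ler_wpM2r ?enorm_ge0// ge_min lexx.
- rewrite SE yconeE; apply: le_trans.
  by rewrite ler_wpM2r ?enorm_ge0// ge_min lexx orbT.
- exact: (cone_frame_independent US Uu Ss).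
- exact: cone_field_nonzero.
- exact: cone_field_nonzero.
Qed.

(** Stated for the sum 4 * (C + C): each of the four points at the ends of the
    window has norm at most C. *)
Lemma same_window_close (F1 F2 : plane -> plane) (G : set plane) KuP KsP
    (lam l C : R) (D : set plane) (P Q : plane) (p q : {ptws int -> bool}) N :
  let F := lozi_map F1 F2 G in
  transverse l KuP KsP -> 0 <= l -> 1 < lam ->
  0 < l * lam ^+ N - (lam ^+ N)^-1 ->
  hyperbolic KuP KsP lam F1 (inv_map F1) ->
  hyperbolic KuP KsP lam F2 (inv_map F2) ->
  infinite_vertical_curve G -> (forall X, G X -> F1 X = F2 X) ->
  injective F -> (forall X, D X -> D (F X)) ->
  (forall X, D X -> `|X| <= C) ->
  (\bigcap_(n in [set: nat]) (iter n F @` D)) P ->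
  (\bigcap_(n in [set: nat]) (iter n F @` D)) Q ->
  itinerary F G P p -> itinerary F G Q q ->
  (forall k, (k < N)%N -> q (Posz k) = p (Posz k) /\ q (Negz k) = p (Negz k)) ->
  (l * lam ^+ N - (lam ^+ N)^-1) * `|Q - P| <= 4 * (C + C).
Proof.
move=> F tr l0 lam1 c0 h1 h2 Gc F12 injF FD DC PL QL Pp Qq pq.
have lam0 : 0 <= lam by lra.
have [P1 P2 P3] := attractor_orbit injF FD PL.
have [Q1 Q2 Q3] := attractor_orbit injF FD QL.
pose Ginv := branch (inv_map F1) (inv_map F2).
have hb b : hyperbolic KuP KsP lam (branch F1 F2 b) (Ginv b).
  by case: b; [exact: h2|exact: h1].
have [h [h' hh] hN] := hyperbolic_orbit lam0 hb (fun k => p (Posz k)) N.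
have hb' b := hyperbolic_sym (hb b).
have [e [e' he] eN] := hyperbolic_orbit lam0 hb' (fun k => p (Negz k)) N.
have fwd X (r : {ptws int -> bool}) (i : nat) : itinerary F G X r ->
    iter i.+1 F X = branch F1 F2 (r (Posz i)) (iter i F X).
  by move=> Xr; exact: (lozi_branch Gc F12 (Xr (Posz i))).
have bwd X (r : {ptws int -> bool}) (i : nat) : itinerary F G X r ->
    (forall k, F (iter k.+1 (inv_map F) X) = iter k (inv_map F) X) ->
    iter i.+1 (inv_map F) X = Ginv (r (Negz i)) (iter i (inv_map F) X).
  move=> Xr X3; have E := lozi_branch Gc F12 (Xr (Negz i)).
  have [[can _ _ _] _] := hb (r (Negz i)).
  rewrite -(X3 i) -[LHS](can (iter i.+1 (inv_map F) X)).
  exact: (congr1 _ (esym E)).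
have ehP : h P = iter N F P.
  by apply: (hN (fun i => iter i F P)) => i _; exact: fwd.
have ehQ : h Q = iter N F Q.
  apply: (hN (fun i => iter i F Q)) => i iN; rewrite (fwd _ _ _ Qq).
  by have [-> _] := pq i iN.
have eeP : e P = iter N (inv_map F) P.
  by apply: (eN (fun i => iter i (inv_map F) P)) => i _; exact: bwd.
have eeQ : e Q = iter N (inv_map F) Q.
  apply: (eN (fun i => iter i (inv_map F) Q)) => i iN; rewrite (bwd _ _ _ Qq Q3).
  by have [_ ->] := pq i iN.
have L0 : 0 < lam ^+ N by rewrite exprn_gt0//; lra.
apply: (hyperbolic_expansive tr l0 L0 c0 hh he).
  by rewrite ehP ehQ (le_trans (ler_normB _ _))// lerD// DC.
by rewrite eeP eeQ (le_trans (ler_normB _ _))// lerD// DC.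
Qed.

End windows.

Theorem lemma4p2 (R : realType) (F1 F2 : 'rV[R]_2 -> 'rV[R]_2)
    (Gamma Lambda : set 'rV[R]_2) (pi : {ptws int -> bool} -> 'rV[R]_2) :
  let F := lozi_map F1 F2 Gamma in
  let Sigma := admissible F Gamma Lambda in
  lozi_like F1 F2 Gamma ->
  attractor F Lambda ->
  (forall p, Sigma p -> Lambda (pi p) /\ itinerary F Gamma (pi p) p) ->
  {within Sigma, continuous pi}.
Proof.
move=> F Sigma [sync [lower1 _] [_ upper2] _ _] [D [tD LE _]] piP.
move: sync => [d1 d2 _ [lam [U [S [KuP [KsP [[lam1 US cfu cfs] H]]]]]]].
move: H => [i1 i2 s1 s2 [Gc div]].
have F12 X : Gamma X -> F1 X = F2 X by move=> /div [].
have h1 := diffeo_hyperbolic d1 i1 s1; have h2 := diffeo_hyperbolic d2 i2 s2.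
have KuU P : KuP P `<=` U by have [] := i1 P.
have KsS P : KsP P `<=` S by have [] := i1 P.
have [l l0 tr] := universal_transverse US cfu cfs KuU KsS.
have injF : injective F.
  have [[k1 _ f1C k1C] _] := h1; have [[k2 _ _ _] _] := h2.
  apply: (lozi_injective Gc (can_inj k1) (can_inj k2) F12).
  - by rewrite lower1.
  - by rewrite upper2.
  - apply: (image_graph_single_valued k1 f1C.1 k1C.1 Gc l0 (K := KuP)).
      by case: tr.
    by move=> P /div [].
have FD X : D X -> D (F X).
  move=> DX; have [[_ trap] _ _] := tD.
  by apply: interior_subset; apply: trap; exists X => //; exact: subset_closure.
have [C C0 DC] := trapping_disk_bounded tD.
apply/subspace_continuousP => p Sp; apply/cvgrPdist_lt => e e0.
have [N hN] := expr_unbounded ((1 + (8 * C) / e) / l) lam1.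
have LN1 : 1 <= lam ^+ N by rewrite exprn_ege1// ltW.
have LNV : (lam ^+ N)^-1 <= 1 by rewrite invf_le1// (lt_le_trans ltr01).
have cN : 8 * C / e < l * lam ^+ N - (lam ^+ N)^-1.
  by move: hN; rewrite ltr_pdivrMr// mulrC => hN; lra.
have c0 : 0 < l * lam ^+ N - (lam ^+ N)^-1.
  by apply: le_lt_trans cN; rewrite divr_ge0 ?(ltW e0)// mulr_ge0.
rewrite /= near_withinE; near=> q => Sq.
have [Pp Ip] := piP p Sp; have [Pq Iq] := piP q Sq.
rewrite LE in Pp Pq.
have pq : forall k, (k < N)%N -> q (Posz k) = p (Posz k) /\ q (Negz k) = p (Negz k).
  by near: q; exact: window_near.
have close := same_window_close tr (ltW l0) lam1 c0 h1 h2 Gc F12 injF FD DC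
  Pp Pq Ip Iq pq.
rewrite distrC -(ltr_pM2l c0) (le_lt_trans close)//.
by move: cN; rewrite ltr_pdivrMr//; lra.
Unshelve. all: by end_near. Qed.
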